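(* Let $\alpha,c>0$, $q\ge0$, $d\ge0$, $h,\tau>0$. For real sequences $u^n=(u_j^n)_{j\in\mathbb{Z}}$, $v^n=(v_j^n)_{j\in\mathbb{Z}}$ in $\ell^2(\mathbb{Z})$, $n=0,1,2,\dots$, consider the one-step schemes, for all $n\ge1$ and $j\in\mathbb{Z}$, $$\frac{u_j^n-u_j^{n-1}}\tau+\frac{v_j^n-v_j^{n-1}}\tau+\Lambda_j^n=0,\qquad \frac{v_j^n-v_j^{n-1}}\tau+\alpha(v_j^n-cu_j^n)=0,$$ where $\Lambda_j^n$ is one of the following: (a) implicit diffusion: $\Lambda_j^n=\frac{d}{h^2}(2u_j^n-u_{j-1}^n-u_{j+1}^n)$; (b) explicit diffusion: $\Lambda_j^n=\frac{d}{h^2}(2u_j^{n-1}-u_{j-1}^{n-1}-u_{j+1}^{n-1})$; (c) implicit upwind advection: $\Lambda_j^n=\frac qh(u_j^n-u_{j-1}^n)$; (d) explicit upwind advection: $\Lambda_j^n=\frac qh(u_j^{n-1}-u_{j-1}^{n-1})$; (e) explicit advection with implicit diffusion: $\Lambda_j^n=\frac qh(u_j^{n-1}-u_{j-1}^{n-1})+\frac{d}{h^2}(2u_j^n-u_{j-1}^n-u_{j+1}^n)$. Then the schemes are strongly stable in the variables $[\sqrt c\,u,v]^T$, i.e. for all $n\ge1$ $$h\sum_{j\in\mathbb{Z}}\left(c\,|u_j^n|^2+|v_j^n|^2\right)\le h\sum_{j\in\mathbb{Z}}\left(c\,|u_j^{n-1}|^2+|v_j^{n-1}|^2\right),$$ under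 the same conditions that apply to the corresponding scalar schemes: (a) and (c) unconditionally; (b) if $4d\frac{\tau}{h^2}\le2$; (d) if $q\tau\le h$; (e) if $q\tau\le h$ (the same condition as for explicit advection).
   Context: These are fully discrete finite difference schemes in one space dimension, on the uniform grid $x_j=jh$, $t_n=n\tau$, for the homogeneous system $u_t+v_t+Lu=0$, $v_t+\alpha(v-cu)=0$, where $Lu=-d\,u_{xx}$ (diffusion), $Lu=q\,u_x$ (advection), or their sum. Strong stability means that the indicated grid norm of the solution does not increase from one time step to the next. *)

(* Defs.v *)
From HB Require Import structures.
From mathcomp Require Import all_boot all_order all_algebra.
From mathcomp Require Import boolp classical_sets reals ereal esum.

Set Implicit Arguments.
Unset Strict Implicit.
Unset Printing Implicit Defensive.
Import Order.TTheory GRing.Theory Num.Theory.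
Local Open Scope classical_set_scope.
Local Open Scope ring_scope.

Definition ell2 (R : realType) (w : int -> R) : Prop :=
  summable [set: int] (fun j => (`|w j| ^+ 2)%:E).

(* The squared grid norm of [sqrt c * u, v]^T, as an extended real: \esum is the
   supremum of the finite partial sums, which is the sum of the series over the
   integers because the terms are nonnegative (for c >= 0). *)
Definition grid_energy (R : realType) (c h : R) (u v : int -> R) : \bar R :=
  (h%:E * \esum_(j in [set: int]) (c * `|u j| ^+ 2 + `|v j| ^+ 2)%:E)%E.

Definition discrete_diffusion (R : realType) (d h : R) (w : int -> R) (j : int)
    : R :=
  d / h ^+ 2 * (2 * w j - w (j - 1) - w (j + 1)).

Definition upwind_advection (R : realType) (q h : R) (w : int -> R) (j : int)
    : R :=
  q / h * (w j - w (j - 1)).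

(* [Lambda unew uold j] approximates (L u)(x_j), where unew and uold are the grid
   functions at the new and at the previous time level. *)
Definition scheme_solution (R : realType) (alpha c tau : R)
    (Lambda : (int -> R) -> (int -> R) -> int -> R) (u v : nat -> int -> R)
    : Prop :=
  forall (n : nat) (j : int),
    (u n.+1 j - u n j) / tau + (v n.+1 j - v n j) / tau
      + Lambda (u n.+1) (u n) j = 0 /\
    (v n.+1 j - v n j) / tau + alpha * (v n.+1 j - c * u n.+1 j) = 0.

Definition strongly_stable (R : realType) (alpha c h tau : R)
    (Lambda : (int -> R) -> (int -> R) -> int -> R) : Prop :=
  forall u v : nat -> int -> R,
    (forall n, ell2 (u n) /\ ell2 (v n)) ->
    scheme_solution alpha c tau Lambda u v ->
    forall n, (grid_energy c h (u n.+1) (v n.+1) <= grid_energy c h (u n) (v n))%E.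

(* Main.v *)
Require Import Defs.
From HB Require Import structures.
From mathcomp Require Import all_boot all_order all_algebra.
From mathcomp Require Import boolp classical_sets reals ereal esum.
From mathcomp Require Import functions fsbigop ring lra.

Set Implicit Arguments.
Unset Strict Implicit.
Unset Printing Implicit Defensive.
Import Order.TTheory GRing.Theory Num.Theory.
Local Open Scope ring_scope.

(** Each of the five schemes, multiplied by tau, has the form
      (1 + b1 + b2) U_j - b1 U_(j-1) - b2 U_(j+1) + V_j = W_j + V0_j,
      W_j = a0 U0_j + a1 U0_(j-1) + a2 U0_(j+1),
    where U0, V0 are the old and U, V the new grid functions, b1 and b2 are
    nonnegative and the weights a_i sum to 1.  The implicit part of Lambda
    supplies the b_i and its explicit part the a_i.  With mu = d tau / h^2 and
    lambda = q tau / h, a step restriction (mu <= 1/2 or lambda <= 1) says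
    exactly that the a_i are nonnegative, so that W is an average of shifts
    of U0, which is what makes the scalar explicit scheme stable.

    Multiply this equation by 2 c U_j.  The coupling equation gives
    V - V0 = - k (V - c U) with k = tau alpha, so
      2 c U (V - V0) = 2 V (V - V0) + 2 k (V - c U)^2,
    which is why sqrt c u and v are the right variables: relaxation only
    dissipates in them.  The remaining products are handled by
    2 x y <= x^2 + y^2 and W_j^2 by convexity of the square, giving the
    pointwise estimate
      c (1 + b1 + b2) U_j^2 + V_j^2
        <= c (b1 U_(j-1)^2 + b2 U_(j+1)^2)
           + c (a0 U0_j^2 + a1 U0_(j-1)^2 + a2 U0_(j+1)^2) + V0_j^2
    ([local_energy_inequality] and [sqr_convex3]).  Summed over the integers,
    all shifts of one grid function contribute the same finite norm, the b_i
    terms cancel, and the a_i add up to 1 ([three_point_stable]). *)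

Lemma sqr_convex3 (R : realFieldType) (a0 a1 a2 x y z : R) :
  0 <= a0 -> 0 <= a1 -> 0 <= a2 -> a0 + a1 + a2 = 1 ->
  (a0 * x + a1 * y + a2 * z) ^+ 2
    <= a0 * x ^+ 2 + a1 * y ^+ 2 + a2 * z ^+ 2.
Proof.
move=> a0_ge0 a1_ge0 a2_ge0 sum_a.
have -> : a0 * x ^+ 2 + a1 * y ^+ 2 + a2 * z ^+ 2 =
    (a0 * x + a1 * y + a2 * z) ^+ 2 + (a0 * a1 * (x - y) ^+ 2
    + a0 * a2 * (x - z) ^+ 2 + a1 * a2 * (y - z) ^+ 2).
  have -> : a0 = 1 - a1 - a2 by lra.
  by ring.
by rewrite lerDl !(sqr_ge0, addr_ge0, mulr_ge0).
Qed.

(** The difference of the two sides is a sum of squares with nonnegative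
    coefficients: numerical dissipation in space and time, and relaxation
    towards y = c * x.  Here x and y are the new values of u and v at a grid
    point, xl and xr the new values of u at its neighbours, w the averaged old
    value of u, s the old value of v, and k = tau * alpha. *)
Lemma local_energy_inequality (R : realFieldType)
    (c k b1 b2 x xl xr y w s : R) :
  0 <= c -> 0 <= k -> 0 <= b1 -> 0 <= b2 ->
  (1 + b1 + b2) * x - b1 * xl - b2 * xr + y = w + s ->
  y - s + k * (y - c * x) = 0 ->
  c * (1 + b1 + b2) * x ^+ 2 + y ^+ 2
    <= c * b1 * xl ^+ 2 + c * b2 * xr ^+ 2 + c * w ^+ 2 + s ^+ 2.
Proof.
move=> c_ge0 k_ge0 b1_ge0 b2_ge0 u_eq v_eq.
have w_eq : w = (1 + b1 + b2) * x - b1 * xl - b2 * xr + y - s by lra.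
have s_eq : s = y + k * (y - c * x) by lra.
rewrite -subr_ge0.
have -> : c * b1 * xl ^+ 2 + c * b2 * xr ^+ 2 + c * w ^+ 2 + s ^+ 2
    - (c * (1 + b1 + b2) * x ^+ 2 + y ^+ 2) =
  c * b1 * (x - xl) ^+ 2 + c * b2 * (x - xr) ^+ 2 + c * (w - x) ^+ 2
    + (y - s) ^+ 2 + 2 * k * (y - c * x) ^+ 2.
  by rewrite w_eq s_eq; ring.
by rewrite !(sqr_ge0, addr_ge0, mulr_ge0).
Qed.

(** As [fine] sends +oo to 0, this is the squared norm on [ell2] only. *)
Definition sqnorm (R : realType) (w : int -> R) : R :=
  fine (\esum_(j in [set: int]) (w j ^+ 2)%:E)%E.

Lemma ge0_esumZl (R : realType) (T : choiceType) (S : set T) (r : R)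
    (a : T -> \bar R) :
  0 <= r -> (forall i, 0 <= a i)%E ->
  (\esum_(i in S) (r%:E * a i) = r%:E * \esum_(i in S) a i)%E.
Proof.
move=> r_ge0 a_ge0; rewrite /esum -ereal_supZl //; last first.
  by apply/set0P; exists 0%E, set0; [exact: fsets_set0 | rewrite fsbig_set0].
rewrite image_comp; congr ereal_sup; apply: eq_imagel => A _ /=.
by rewrite ge0_mule_fsumr.
Qed.

Lemma esum_shift (R : realType) (s : int) (a : int -> \bar R) :
  (\esum_(j in [set: int]) a (j + s)%R = \esum_(j in [set: int]) a j)%E.
Proof.
apply/esym/reindex_esum; rewrite setTT_bijective.
by exists (fun j : int => j - s) => j; rewrite ?addrK ?subrK.
Qed.

(** Nonnegativity is part of the notion because sums in the extended reals
    are additive only for families of nonnegative terms. *)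
Definition ge0_sum (R : realType) (f : int -> R) (S : R) : Prop :=
  (forall j, 0 <= f j) /\ (\esum_(j in [set: int]) (f j)%:E = S%:E)%E.

Lemma ge0_sumD (R : realType) (f g : int -> R) (S T : R) :
  ge0_sum f S -> ge0_sum g T -> ge0_sum (fun j => f j + g j) (S + T).
Proof.
move=> [f_ge0 f_sum] [g_ge0 g_sum]; split=> [j|]; first exact: addr_ge0.
under eq_esum do rewrite EFinD.
by rewrite esumD ?f_sum ?g_sum // => j _; rewrite lee_fin.
Qed.

Lemma ge0_sum_le (R : realType) (f g : int -> R) (S T : R) :
  ge0_sum f S -> ge0_sum g T -> (forall j, f j <= g j) -> S <= T.
Proof.
move=> [_ f_sum] [_ g_sum] fg; rewrite -lee_fin -f_sum -g_sum.
by apply: le_esum => j _; rewrite lee_fin.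
Qed.

Lemma ge0_sum_shift (R : realType) (s : int) (f : int -> R) (S : R) :
  ge0_sum f S -> ge0_sum (fun j => f (j + s)) S.
Proof.
by move=> [f_ge0 f_sum]; split=> //; rewrite (esum_shift s (fun j => (f j)%:E)).
Qed.

Lemma ge0_sum_sqr (R : realType) (r : R) (w : int -> R) :
  ell2 w -> 0 <= r -> ge0_sum (fun j => r * w j ^+ 2) (r * sqnorm w).
Proof.
move=> w_ell2 r_ge0; split=> [j|]; first by rewrite mulr_ge0 // sqr_ge0.
under eq_esum do rewrite EFinM.
rewrite ge0_esumZl // => [|j]; last by rewrite lee_fin sqr_ge0.
rewrite EFinM fineK //; move: w_ell2; rewrite /ell2 summableE.
congr (_ \is a fin_num); apply: eq_esum => j _ /=.
by rewrite real_normK ?num_real // ger0_norm // sqr_ge0.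
Qed.

Lemma grid_energyE (R : realType) (c h : R) (u v : int -> R) :
  0 <= c -> ell2 u -> ell2 v ->
  grid_energy c h u v = (h * (c * sqnorm u + sqnorm v))%:E.
Proof.
move=> c_ge0 u_ell2 v_ell2; rewrite /grid_energy EFinM; congr (_ * _)%E.
rewrite -[sqnorm v]mul1r.
have [_ <-] := ge0_sumD (ge0_sum_sqr u_ell2 c_ge0) (ge0_sum_sqr v_ell2 ler01).
by apply: eq_esum => j _; rewrite !real_normK ?num_real // mul1r.
Qed.

(** A step that is implicit with coefficients b1, b2 and an average with
    weights a0, a1, a2 on the old level does not increase the energy: the
    pointwise estimate is summed in the reals, where finiteness of the norm of
    the new level allows the b1 and b2 terms to be cancelled. *)
Lemma three_point_stable (R : realType) (alpha c h tau a0 a1 a2 b1 b2 : R)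
    (Lambda : (int -> R) -> (int -> R) -> int -> R) :
  0 < alpha -> 0 < c -> 0 < h -> 0 < tau ->
  0 <= a0 -> 0 <= a1 -> 0 <= a2 -> a0 + a1 + a2 = 1 ->
  0 <= b1 -> 0 <= b2 ->
  (forall unew uold j, tau * Lambda unew uold j =
     (b1 + b2) * unew j - b1 * unew (j - 1) - b2 * unew (j + 1)
     + uold j - (a0 * uold j + a1 * uold (j - 1) + a2 * uold (j + 1))) ->
  strongly_stable alpha c h tau Lambda.
Proof.
move=> alpha_gt0 c_gt0 h_gt0 tau_gt0 a0_ge0 a1_ge0 a2_ge0 sum_a b1_ge0 b2_ge0.
move=> Lambda_eq u v uv_ell2 uv_sol n.
have c_ge0 := ltW c_gt0.
have [[p_ell2 s_ell2] [x_ell2 y_ell2]] := (uv_ell2 n, uv_ell2 n.+1).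
rewrite !grid_energyE // lee_fin ler_pM2l //.
have pointwise j : c * (1 + b1 + b2) * u n.+1 j ^+ 2 + 1 * v n.+1 j ^+ 2
    <= c * b1 * u n.+1 (j - 1) ^+ 2 + c * b2 * u n.+1 (j + 1) ^+ 2
       + c * a0 * u n j ^+ 2 + c * a1 * u n (j - 1) ^+ 2
       + c * a2 * u n (j + 1) ^+ 2 + 1 * v n j ^+ 2.
  have [u_eq v_eq] := uv_sol n j.
  have tau_neq0 : tau != 0 by rewrite gt_eqF.
  set w := a0 * u n j + a1 * u n (j - 1) + a2 * u n (j + 1).
  have u_eq' : (1 + b1 + b2) * u n.+1 j - b1 * u n.+1 (j - 1)
      - b2 * u n.+1 (j + 1) + v n.+1 j = w + v n j.
    have := Lambda_eq (u n.+1) (u n) j; rewrite -/w.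
    have -> : tau * Lambda (u n.+1) (u n) j
        = - (u n.+1 j - u n j + (v n.+1 j - v n j)).
      apply/eqP; rewrite -addr_eq0; apply/eqP.
      by rewrite -[RHS](mulr0 tau) -u_eq; field.
    lra.
  have v_eq' : v n.+1 j - v n j
      + tau * alpha * (v n.+1 j - c * u n.+1 j) = 0.
    by rewrite -[RHS](mulr0 tau) -v_eq; field.
  have k_ge0 : 0 <= tau * alpha by rewrite mulr_ge0 // ltW.
  have := local_energy_inequality c_ge0 k_ge0 b1_ge0 b2_ge0 u_eq' v_eq'.
  have : c * w ^+ 2 <= c * (a0 * u n j ^+ 2 + a1 * u n (j - 1) ^+ 2
                            + a2 * u n (j + 1) ^+ 2).
    by rewrite ler_pM2l // sqr_convex3.
  lra.
have cb1_ge0 := mulr_ge0 c_ge0 b1_ge0; have cb2_ge0 := mulr_ge0 c_ge0 b2_ge0.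
have ca0_ge0 := mulr_ge0 c_ge0 a0_ge0; have ca1_ge0 := mulr_ge0 c_ge0 a1_ge0.
have ca2_ge0 := mulr_ge0 c_ge0 a2_ge0.
have cb_ge0 : 0 <= c * (1 + b1 + b2) by rewrite mulr_ge0 // !addr_ge0.
have lhs := ge0_sumD (ge0_sum_sqr x_ell2 cb_ge0) (ge0_sum_sqr y_ell2 ler01).
have rhs := ge0_sumD (ge0_sumD (ge0_sumD (ge0_sumD (ge0_sumD
  (ge0_sum_shift (-1) (ge0_sum_sqr x_ell2 cb1_ge0))
  (ge0_sum_shift 1 (ge0_sum_sqr x_ell2 cb2_ge0)))
  (ge0_sum_sqr p_ell2 ca0_ge0))
  (ge0_sum_shift (-1) (ge0_sum_sqr p_ell2 ca1_ge0)))
  (ge0_sum_shift 1 (ge0_sum_sqr p_ell2 ca2_ge0)))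
  (ge0_sum_sqr s_ell2 ler01).
have := ge0_sum_le lhs rhs pointwise.
(* The weights occur in products with c and the norm of the old level;
   eliminating a0 makes these nonlinear terms cancel identically. *)
have a0_eq : a0 = 1 - a1 - a2 by lra.
rewrite a0_eq; lra.
Qed.

Theorem proposition2 (R : realType) (alpha c q d h tau : R)
    (halpha : 0 < alpha) (hc : 0 < c) (hq : 0 <= q) (hd : 0 <= d)
    (hh : 0 < h) (htau : 0 < tau) :
  [/\ (* (a) implicit diffusion *)
      strongly_stable alpha c h tau
        (fun unew _ j => discrete_diffusion d h unew j),
      (* (b) explicit diffusion *)
      4 * d * (tau / h ^+ 2) <= 2 ->
      strongly_stable alpha c h tau
        (fun _ uold j => discrete_diffusion d h uold j),
      (* (c) implicit upwind advection *)
      strongly_stable alpha c h tau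
        (fun unew _ j => upwind_advection q h unew j),
      (* (d) explicit upwind advection *)
      q * tau <= h ->
      strongly_stable alpha c h tau
        (fun _ uold j => upwind_advection q h uold j)
    & (* (e) explicit advection with implicit diffusion *)
      q * tau <= h ->
      strongly_stable alpha c h tau
        (fun unew uold j =>
           upwind_advection q h uold j + discrete_diffusion d h unew j)].
Proof.
have h_neq0 : h != 0 by rewrite gt_eqF.
set mu := d * tau / h ^+ 2; set lambda := q * tau / h.
have mu_ge0 : 0 <= mu by rewrite divr_ge0 ?mulr_ge0 ?sqr_ge0 // ltW.
have lambda_ge0 : 0 <= lambda by rewrite divr_ge0 ?mulr_ge0 // ltW.
have lambda_le1 : q * tau <= h -> 0 <= 1 - lambda.
  by move=> cfl; rewrite subr_ge0 ler_pdivrMr // mul1r.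
split=> [|cfl||cfl|cfl].
- by apply: (@three_point_stable R alpha c h tau 1 0 0 mu mu) => //;
    [lra | move=> x p j; rewrite /discrete_diffusion /mu; field].
- have mu_le : 0 <= 1 - mu - mu.
    have -> : 1 - mu - mu = (2 - 4 * d * (tau / h ^+ 2)) / 2.
      by rewrite /mu; field.
    by rewrite divr_ge0 // subr_ge0.
  by apply: (@three_point_stable R alpha c h tau (1 - mu - mu) mu mu 0 0) => //;
    [lra | move=> x p j; rewrite /discrete_diffusion /mu; field].
- by apply: (@three_point_stable R alpha c h tau 1 0 0 lambda 0) => //;
    [lra | move=> x p j; rewrite /upwind_advection /lambda; field].
- by apply: (@three_point_stable R alpha c h tau (1 - lambda) lambda 0 0 0) => //;
    [exact: lambda_le1 | lra
    | move=> x p j; rewrite /upwind_advection /lambda; field].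
- by apply: (@three_point_stable R alpha c h tau (1 - lambda) lambda 0 mu mu)
    => //; [exact: lambda_le1 | lra
    | move=> x p j;
      rewrite /upwind_advection /discrete_diffusion /lambda /mu; field].
Qed.
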